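(* Let $K$ be an algebraically closed field and let $A=KQ/I$ be a polygon-tree algebra over $K$. Then $A$ is a schurian algebra, i.e. $\dim_K\mathrm{Hom}_A(P_i,P_j)\le 1$ for any two vertices $i,j$ of $Q$, where $P_i$ denotes the indecomposable projective $A$-module at $i$.
   Context: A quiver with potential (QP) $(Q,W)$ is a quiver $Q$ with a (possibly infinite) linear combination $W$ of cyclic paths. The cyclic derivative is $\partial_a(a_1\cdots a_l)=\sum_{a_i=a}a_{i+1}\cdots a_la_1\cdots a_{i-1}$, extended linearly and continuously. The Jacobian algebra $J(Q,W)$ is the quotient of the complete path algebra $\widehat{KQ}$ by the closure of the ideal generated by all $\partial_aW$, $a$ an arrow of $Q$. Polygon-tree algebras. Let $Q_0,\dots,Q_N$ ($N\ge 0$) be oriented cycles with at least $3$ vertices each. Start with $Q_0$. For $t=1,\dots,N$ inductively, choose an arrow of the quiver $Q_{0,\dots,t-1}$ already constructed which is not one of the arrows previously used for a gluing, and an arrow of $Q_t$, and let $Q_{0,\dots,t}$ be obtained from $Q_{0,\dots,t-1}$ and $Q_t$ by identifying these two arrows (with their sources and targets). The quiver $Q=Q_{0,\dots,N}$ is a polygon-tree quiver. With $W=\sum_{i=0}^N w_i$, $w_i$ the oriented cycle along $Q_i$, the algebra $A=J(Q,W)=KQ/I$ is a polygon-tree algebra. The vertex $i\neq j$ condition is not imposed: $i=j$ is included. *)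

(* Defs.v *)
From HB Require Import structures.
From mathcomp Require Import all_boot all_algebra.
From mathcomp Require Import boolp functions.

Set Implicit Arguments.
Unset Strict Implicit.
Unset Printing Implicit Defensive.

Import GRing.Theory.
Local Open Scope ring_scope.
Local Open Scope quotient_scope.

(* Finite quivers; loops and multiple arrows are allowed. *)
Record quiver := Quiver {
  vertex : finType;
  arrow : finType;
  src : arrow -> vertex;
  tgt : arrow -> vertex
}.

Section Paths.
Variable Q : quiver.

(* Paths are read from left to right: [:: a1; ...; al] is a path when
   tgt a_k = src a_(k+1). *)
Fixpoint is_path (v : vertex Q) (s : seq (arrow Q)) : bool :=
  if s is a :: s' then (src a == v) && is_path (tgt a) s' else true.

Definition path_end (v : vertex Q) (s : seq (arrow Q)) : vertex Q :=
  last v (map (@tgt Q) s).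

(* The starting vertex is recorded so that there is one path of length 0
   at each vertex. *)
Definition qpath := {p : vertex Q * seq (arrow Q) | is_path p.1 p.2}.

Definition arrows (p : qpath) : seq (arrow Q) := (val p).2.
Definition plen (p : qpath) : nat := size (arrows p).

Lemma is_path_cat v s t :
  is_path v (s ++ t) = is_path v s && is_path (path_end v s) t.
Proof. by elim: s v => [|a s IHs] v //=; rewrite IHs andbA. Qed.

Fact ptake_subproof n (p : qpath) :
  is_path (val p).1 (take n (arrows p)).
Proof.
by have := valP p; rewrite -{1}(cat_take_drop n (val p).2) is_path_cat => /andP[].
Qed.

Definition ptake n (p : qpath) : qpath :=
  exist _ ((val p).1, take n (arrows p)) (ptake_subproof n p).

Fact pdrop_subproof n (p : qpath) :
  is_path (path_end (val p).1 (take n (arrows p))) (drop n (arrows p)).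
Proof.
by have := valP p; rewrite -{1}(cat_take_drop n (val p).2) is_path_cat => /andP[].
Qed.

Definition pdrop n (p : qpath) : qpath :=
  exist _ (path_end (val p).1 (take n (arrows p)), drop n (arrows p))
    (pdrop_subproof n p).

Lemma plen_take n p : (n <= plen p)%N -> plen (ptake n p) = n.
Proof. exact: size_takel. Qed.

Lemma plen_drop n p : plen (pdrop n p) = (plen p - n)%N.
Proof. exact: size_drop. Qed.

Lemma ptake_take i j p : (j <= i)%N -> ptake j (ptake i p) = ptake j p.
Proof. by move=> ji; apply: val_inj; rewrite /= /arrows /= take_takel. Qed.

Lemma pdrop_take k j p : pdrop j (ptake (j + k) p) = ptake k (pdrop j p).
Proof.
apply: val_inj; rewrite /= /arrows /= take_takel ?leq_addr //.
by rewrite addnC take_drop.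
Qed.

Lemma pdrop_drop k j p : pdrop k (pdrop j p) = pdrop (j + k) p.
Proof.
apply: val_inj; rewrite /= /arrows /= drop_drop addnC.
by rewrite takeD /path_end map_cat last_cat.
Qed.

Lemma pdrop0 p : pdrop 0 p = p.
Proof. by apply: val_inj; case: p => -[v s] h; rewrite /= /arrows /= take0 drop0. Qed.

Lemma ptake_len p : ptake (plen p) p = p.
Proof. by apply: val_inj; case: p => -[v s] h; rewrite /= /plen /arrows /= take_size. Qed.

End Paths.

(* The complete path algebra: arbitrary formal K-linear combinations of paths,
   with the concatenation product. *)
Section CompletePathAlgebra.
Variables (K : fieldType) (Q : quiver).

Definition cpathalg := qpath Q -> K.

HB.instance Definition _ := GRing.Lmodule.copy cpathalg (qpath Q -> K^o).

Implicit Types (f g h : cpathalg) (p : qpath Q).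

Definition cpa_one : cpathalg := fun p => (plen p == 0)%N%:R.

Definition cpa_mul f g : cpathalg :=
  fun p => \sum_(i < (plen p).+1) f (ptake i p) * g (pdrop i p).

(* The element of the algebra given by a word starting at v; it is 0 when the
   word is not a path. *)
Definition path_elt (v : vertex Q) (s : seq (arrow Q)) : cpathalg :=
  fun p => (val p == (v, s))%:R.

Lemma cpaP f g : (forall p, f p = g p) -> f = g.
Proof. by move=> fg; apply: funext. Qed.

Lemma cpaD f g p : (f + g) p = f p + g p. Proof. by []. Qed.
Lemma cpaN f p : (- f) p = - f p. Proof. by []. Qed.
Lemma cpaZ c f p : (c *: f) p = c * f p. Proof. by []. Qed.
Lemma cpa0 p : (0 : cpathalg) p = 0. Proof. by []. Qed.

Fact cpa_mulA : associative cpa_mul.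
Proof.
move=> f g h; apply: cpaP => p; rewrite /cpa_mul.
under eq_bigr do rewrite mulr_sumr.
under [RHS]eq_bigr do rewrite mulr_suml.
pose F (j k : nat) :=
  f (ptake j p) * (g (ptake k (pdrop j p)) * h (pdrop (j + k) p)).
transitivity (\sum_(j < (plen p).+1) \sum_(i < (plen p).+1 | (j <= i)%N)
    F j (i - j)%N).
  apply: eq_bigr => j _; rewrite plen_drop.
  have jp : (j <= plen p)%N by rewrite -ltnS.
  rewrite -(big_mkord xpredT
    (fun k => f (ptake j p) * (g (ptake k (pdrop j p)) * h (pdrop k (pdrop j p))))).
  rewrite -(big_mkord (fun i => (j <= i)%N) (fun i => F j (i - j)%N)).
  rewrite [RHS](big_cat_nat (n := j)) //=; last by rewrite ltnW.
  rewrite [X in _ = X + _]big_nat_cond [X in _ = X + _]big_pred0 ?add0r; last first.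
    by move=> i; case: (leqP j i); rewrite ?andbF.
  have shift (P : pred nat) (G : nat -> K) :
    \sum_(j <= i < (plen p).+1 | P i) G i =
    \sum_(0 <= i < (plen p).+1 - j | P (i + j)%N) G (i + j)%N.
    by rewrite -{1}[nat_of_ord j]add0n big_addn.
  rewrite shift subSn //.
  rewrite [RHS]big_mkcond; apply: eq_bigr => k _.
  by rewrite leq_addl addnK pdrop_drop.
rewrite (exchange_big_dep xpredT) //=; apply: eq_bigr => i _.
have ip : (i <= plen p)%N by rewrite -ltnS.
rewrite plen_take // -(big_mkord xpredT
  (fun j => f (ptake j (ptake i p)) * g (pdrop j (ptake i p)) * h (pdrop i p))).
rewrite -(big_mkord (fun j => (j <= i)%N) (fun j => F j (i - j)%N)).
rewrite [LHS](big_cat_nat (n := i.+1)) //=.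
rewrite [X in _ + X]big_nat_cond [X in _ + X]big_pred0 ?addr0; last first.
  by move=> j; rewrite ltnNge; case: (leqP j i); rewrite ?andbF.
rewrite big_nat_cond [RHS]big_nat_cond; apply: eq_big.
  by move=> j; rewrite ltnS leq0n andTb andbT andbb.
move=> j /andP[_ ji]; rewrite ptake_take //.
have -> : pdrop j (ptake i p) = ptake (i - j) (pdrop j p).
  by rewrite -{1}(subnKC ji) pdrop_take.
by rewrite /F subnKC // mulrA.
Qed.

Fact cpa_mul1r : left_id cpa_one cpa_mul.
Proof.
move=> f; apply: cpaP => p; rewrite /cpa_mul big_ord_recl /=.
rewrite /cpa_one plen_take // eqxx mul1r pdrop0 big1 ?addr0 // => i _.
by rewrite plen_take // mul0r.
Qed.

Fact cpa_mulr1 : right_id cpa_one cpa_mul.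
Proof.
move=> f; apply: cpaP => p; rewrite /cpa_mul big_ord_recr /=.
rewrite /cpa_one plen_drop subnn eqxx mulr1 ptake_len big1 ?add0r // => i _.
by rewrite plen_drop subn_eq0 leqNgt ltn_ord mulr0.
Qed.

Fact cpa_mulDl : left_distributive cpa_mul +%R.
Proof.
move=> f g h; apply: cpaP => p; rewrite cpaD -big_split /=.
by apply: eq_bigr => i _; rewrite cpaD mulrDl.
Qed.

Fact cpa_mulDr : right_distributive cpa_mul +%R.
Proof.
move=> f g h; apply: cpaP => p; rewrite cpaD -big_split /=.
by apply: eq_bigr => i _; rewrite cpaD mulrDr.
Qed.

HB.instance Definition _ := GRing.Zmodule_isPzRing.Build cpathalg
  cpa_mulA cpa_mul1r cpa_mulr1 cpa_mulDl cpa_mulDr.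

Lemma cpaM f g p :
  (f * g) p = \sum_(i < (plen p).+1) f (ptake i p) * g (pdrop i p).
Proof. by []. Qed.

Lemma cpa_scaleAl (c : K) f g : c *: (f * g) = (c *: f) * g.
Proof.
apply: cpaP => p; rewrite cpaZ !cpaM mulr_sumr; apply: eq_bigr => i _.
by rewrite cpaZ mulrA.
Qed.

Lemma cpa_scaleAr (c : K) f g : c *: (f * g) = f * (c *: g).
Proof.
apply: cpaP => p; rewrite cpaZ !cpaM mulr_sumr; apply: eq_bigr => i _.
by rewrite cpaZ mulrCA.
Qed.

(* As Q is finite, the powers of the arrow ideal m are the sets of elements
   supported on paths of length >= n, and the closure of S for the m-adic
   topology is the intersection of the S + m^n. *)
Definition madic_closure (S : cpathalg -> Prop) (x : cpathalg) : Prop :=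
  forall n : nat, exists2 y, S y & forall p, (plen p < n)%N -> x p = y p.

End CompletePathAlgebra.

Section JacobianAlgebra.
Variables (K : fieldType) (Q : quiver).

Definition is_cyclic (c : seq (arrow Q)) : bool :=
  (c != [::]) && cycle (fun a b : arrow Q => tgt a == src b) c.

Definition potential := {c : seq (arrow Q) | is_cyclic c} -> K.

Definition coefW (W : potential) (c : seq (arrow Q)) : K :=
  if insub c is Some c' then W c' else 0.

Definition cder_cycle (a : arrow Q) (c : seq (arrow Q)) : cpathalg K Q :=
  \sum_(i < size c | onth c i == Some a)
    path_elt K (tgt a) (drop i.+1 c ++ take i c).

(* The linear and continuous extension of cder_cycle: only the finitely many
   words of length l + 1 contribute to the coefficients at paths of length l. *)
Definition cder (W : potential) (a : arrow Q) : cpathalg K Q :=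
  fun p => \sum_(c : (plen p).+1.-tuple (arrow Q))
             coefW W c * cder_cycle a c p.

Definition cder_ideal (W : potential) (x : cpathalg K Q) : Prop :=
  exists s : seq (cpathalg K Q * arrow Q * cpathalg K Q),
    x = \sum_(t <- s) t.1.1 * cder W t.1.2 * t.2.

Definition jac_ideal (W : potential) : {pred cpathalg K Q} :=
  fun x => `[< madic_closure (cder_ideal W) x >].

Lemma jac_idealP W x :
  reflect (madic_closure (cder_ideal W) x) (x \in jac_ideal W).
Proof. exact: asboolP. Qed.

Lemma cder_ideal0 W : cder_ideal W 0.
Proof. by exists [::]; rewrite big_nil. Qed.

Lemma cder_idealD W x y :
  cder_ideal W x -> cder_ideal W y -> cder_ideal W (x + y).
Proof. by move=> [s ->] [t ->]; exists (s ++ t); rewrite big_cat. Qed.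

Lemma cder_idealMl W u x : cder_ideal W x -> cder_ideal W (u * x).
Proof.
move=> [s ->]; exists [seq (u * t.1.1, t.1.2, t.2) | t <- s].
by rewrite big_map mulr_sumr; apply: eq_bigr => t _; rewrite /= !mulrA.
Qed.

Lemma cder_idealMr W u x : cder_ideal W x -> cder_ideal W (x * u).
Proof.
move=> [s ->]; exists [seq (t.1.1, t.1.2, t.2 * u) | t <- s].
by rewrite big_map mulr_suml; apply: eq_bigr => t _; rewrite /= !mulrA.
Qed.

Lemma jac_idealMl W u x : x \in jac_ideal W -> u * x \in jac_ideal W.
Proof.
move=> /jac_idealP xW; apply/jac_idealP => n; have [y yW xy] := xW n.
exists (u * y); first exact: cder_idealMl.
move=> p pn; rewrite !cpaM; apply: eq_bigr => i _; congr (_ * _).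
by apply: xy; apply: leq_ltn_trans pn; rewrite plen_drop leq_subr.
Qed.

Lemma jac_idealMr W u x : x \in jac_ideal W -> x * u \in jac_ideal W.
Proof.
move=> /jac_idealP xW; apply/jac_idealP => n; have [y yW xy] := xW n.
exists (y * u); first exact: cder_idealMr.
move=> p pn; rewrite !cpaM; apply: eq_bigr => i _; congr (_ * _).
by apply: xy; apply: leq_ltn_trans pn; rewrite plen_take -ltnS.
Qed.

Fact jac_ideal_zmod_closed W : zmod_closed (jac_ideal W).
Proof.
split=> [|x y xW yW].
  by apply/jac_idealP => n; exists 0 => //; apply: cder_ideal0.
have /jac_idealP {}yW : - y \in jac_ideal W by rewrite -mulN1r jac_idealMl.
move/jac_idealP: xW => xW; apply/jac_idealP => n.
have [x' x'W xx'] := xW n; have [y' y'W yy'] := yW n.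
exists (x' + y'); first exact: cder_idealD.
by move=> p pn; rewrite !cpaD xx' ?yy'.
Qed.

HB.instance Definition _ W :=
  GRing.isZmodClosed.Build (cpathalg K Q) (jac_ideal W)
    (jac_ideal_zmod_closed W).

Variable W : potential.

Definition jacobian : Type := Quotient.quot (jac_ideal W).

HB.instance Definition _ := GRing.Zmodule.on jacobian.
HB.instance Definition _ := EqQuotient.on jacobian.

Definition jproj (x : cpathalg K Q) : jacobian := \pi_jacobian x.

Lemma jprojP x y : jproj x = jproj y <-> x - y \in jac_ideal W.
Proof.
by rewrite (Quotient.idealrBE (jac_ideal W) x y); split=> [xy|/eqP//]; apply/eqP.
Qed.

Lemma jprojK (x : jacobian) : jproj (repr x) = x.
Proof. exact: reprK. Qed.

Lemma jprojD x y : jproj (x + y) = jproj x + jproj y.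
Proof. exact: (Quotient.pi_add (jac_ideal W)). Qed.

Definition jac_one : jacobian := jproj 1.

Definition jac_mul (x y : jacobian) : jacobian := jproj (repr x * repr y).

Definition jac_scale (c : K) (x : jacobian) : jacobian := jproj (c *: repr x).

Lemma jproj_mul x y : jac_mul (jproj x) (jproj y) = jproj (x * y).
Proof.
apply/jprojP.
set x' := repr _; set y' := repr _.
have xx' : x' - x \in jac_ideal W by apply/jprojP; rewrite jprojK.
have yy' : y' - y \in jac_ideal W by apply/jprojP; rewrite jprojK.
rewrite -(subrK (x' * y) (x' * y')) -mulrBr -addrA -mulrBl.
by apply: rpredD; [apply: jac_idealMl|apply: jac_idealMr].
Qed.

Lemma jproj_scale c x : jac_scale c (jproj x) = jproj (c *: x).
Proof.
apply/jprojP; rewrite -scalerBr -[_ - _]mul1r cpa_scaleAl jac_idealMl //.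
by apply/jprojP; rewrite jprojK.
Qed.

Fact jac_mulA : associative jac_mul.
Proof.
move=> x y z; rewrite -[x]jprojK -[y]jprojK -[z]jprojK.
by rewrite !jproj_mul mulrA.
Qed.

Fact jac_mul1r : left_id jac_one jac_mul.
Proof. by move=> x; rewrite -[x]jprojK jproj_mul mul1r. Qed.

Fact jac_mulr1 : right_id jac_one jac_mul.
Proof. by move=> x; rewrite -[x]jprojK jproj_mul mulr1. Qed.

Fact jac_mulDl : left_distributive jac_mul +%R.
Proof.
move=> x y z; rewrite -[x]jprojK -[y]jprojK -[z]jprojK.
by rewrite -jprojD !jproj_mul -jprojD mulrDl.
Qed.

Fact jac_mulDr : right_distributive jac_mul +%R.
Proof.
move=> x y z; rewrite -[x]jprojK -[y]jprojK -[z]jprojK.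
by rewrite -jprojD !jproj_mul -jprojD mulrDr.
Qed.

HB.instance Definition _ := GRing.Zmodule_isPzRing.Build jacobian
  jac_mulA jac_mul1r jac_mulr1 jac_mulDl jac_mulDr.

Fact jac_scaleA a b x : jac_scale a (jac_scale b x) = jac_scale (a * b) x.
Proof. by rewrite -[x]jprojK !jproj_scale scalerA. Qed.

Fact jac_scale1 : left_id 1 jac_scale.
Proof. by move=> x; rewrite -[x]jprojK jproj_scale scale1r. Qed.

Fact jac_scaleDr : right_distributive jac_scale +%R.
Proof.
move=> a x y; rewrite -[x]jprojK -[y]jprojK.
by rewrite -jprojD !jproj_scale -jprojD scalerDr.
Qed.

Fact jac_scaleDl x : {morph jac_scale^~ x : a b / a + b}.
Proof.
by move=> a b /=; rewrite -[x]jprojK !jproj_scale -jprojD scalerDl.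
Qed.

HB.instance Definition _ := GRing.Zmodule_isLmodule.Build K jacobian
  jac_scaleA jac_scale1 jac_scaleDr jac_scaleDl.

Lemma jprojM x y : jproj (x * y) = jproj x * jproj y.
Proof. by rewrite -jproj_mul. Qed.

Lemma jprojZ c x : jproj (c *: x) = c *: jproj x.
Proof. by rewrite -jproj_scale. Qed.

(* With the next two lemmas, jacobian is a K-algebra. It is not declared as an
   algType, which would require 1 != 0; this fails for the empty quiver. *)
Lemma jac_scaleAl (c : K) (x y : jacobian) : c *: (x * y) = (c *: x) * y.
Proof.
rewrite -[x]jprojK -[y]jprojK -jprojM -(jprojZ c (repr x)) -jprojM -jprojZ.
by rewrite cpa_scaleAl.
Qed.

Lemma jac_scaleAr (c : K) (x y : jacobian) : c *: (x * y) = x * (c *: y).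
Proof.
rewrite -[x]jprojK -[y]jprojK -jprojM -(jprojZ c (repr y)) -jprojM -jprojZ.
by rewrite cpa_scaleAr.
Qed.

Definition jidem (i : vertex Q) : jacobian := jproj (path_elt K i [::]).

(* P_i is the left ideal A e_i, as a submodule of the left regular module. *)
Definition in_projective (i : vertex Q) : {pred jacobian^o} :=
  fun x => `[< exists y : jacobian, x = y * jidem i >].

Fact in_projective_submod_closed i : submod_closed (in_projective i).
Proof.
split; first by apply/asboolP; exists 0; rewrite mul0r.
move=> a x y /asboolP[u ->] /asboolP[v ->]; apply/asboolP.
by exists (a * u + v); rewrite mulrDl -mulrA.
Qed.

HB.instance Definition _ i :=
  GRing.isSubmodClosed.Build jacobian jacobian^o (in_projective i)
    (in_projective_submod_closed i).

Definition projective (i : vertex Q) : Type :=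
  {x : jacobian^o | x \in in_projective i}.

HB.instance Definition _ i := SubChoice.on (projective i).
HB.instance Definition _ i :=
  [SubChoice_isSubLmodule of projective i by <:].

(* Hom_A(M, N) has a K-basis with m elements, where c : K acts on homs by
   (c . f) x = (c *: 1) *: f x. *)
Definition hom_has_dim (M N : lmodType jacobian) (m : nat) : Prop :=
  exists b : 'I_m -> {linear M -> N},
    forall f : {linear M -> N}, exists! c : 'rV[K]_m,
      forall x : M, f x = \sum_(k < m) (c 0 k *: (1 : jacobian)) *: b k x.

Definition schurian : Prop :=
  forall i j : vertex Q,
    exists2 m, (m <= 1)%N & hom_has_dim (projective i) (projective j) m.

End JacobianAlgebra.

Section PolygonTrees.

(* The oriented cycle 0 -> 1 -> ... -> n - 1 -> 0, arrow i starting at i. *)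
Definition cycle_quiver (n : nat) : quiver :=
  @Quiver 'I_n 'I_n id (@ordS n).

(* The quiver obtained from Q1 and Q2 by identifying the arrow a of Q1 with the
   arrow b of Q2, along with their sources and targets; a and b should not be
   loops. The image of Q2 is given by glue_vertex and glue_arrow. *)
Section Glue.
Variables (Q1 : quiver) (a : arrow Q1) (Q2 : quiver) (b : arrow Q2).

Let V := (vertex Q1 + {v : vertex Q2 | (v != src b) && (v != tgt b)})%type.
Let E := (arrow Q1 + {e : arrow Q2 | e != b})%type.

Definition glue_vertex (v : vertex Q2) : V :=
  if insub v is Some u then inr u
  else inl (if v == src b then src a else tgt a).

Definition glue_arrow (e : arrow Q2) : E :=
  if insub e is Some u then inr u else inl a.

Definition glue : quiver :=
  @Quiver V E
    (fun e => match e with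
              | inl e1 => inl (src e1)
              | inr e2 => glue_vertex (src (val e2))
              end)
    (fun e => match e with
              | inl e1 => inl (tgt e1)
              | inr e2 => glue_vertex (tgt (val e2))
              end).

Definition glue_inl (e : arrow Q1) : arrow glue := inl e.
Definition glue_inr (e : arrow Q2) : arrow glue := glue_arrow e.

End Glue.

(* polygon_tree ws used: Q is a polygon-tree quiver, ws lists the oriented
   cycles along Q_0, ..., Q_N in Q, and used is the set of the arrows of Q at
   which a gluing has taken place. *)
Inductive polygon_tree :
  forall Q : quiver, seq (seq (arrow Q)) -> {set arrow Q} -> Prop :=
| polygon_tree_cycle n :
    (3 <= n)%N ->
    @polygon_tree (cycle_quiver n) [:: enum 'I_n] set0
| polygon_tree_glue Q ws used (a : arrow Q) n (b : arrow (cycle_quiver n)) :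
    @polygon_tree Q ws used -> a \notin used -> (3 <= n)%N ->
    @polygon_tree (glue a b)
      (rcons [seq map (glue_inl a b) w | w <- ws]
             (map (glue_inr a b) (enum 'I_n)))
      (glue_inl a b a |: [set glue_inl a b e | e in used])
| polygon_tree_iso Q Q' ws used (fv : vertex Q -> vertex Q')
    (fa : arrow Q -> arrow Q') :
    @polygon_tree Q ws used -> bijective fv -> bijective fa ->
    (forall e, src (fa e) = fv (src e)) ->
    (forall e, tgt (fa e) = fv (tgt e)) ->
    @polygon_tree Q' [seq map fa w | w <- ws] [set fa e | e in used].

Definition polygon_potential (K : fieldType) (Q : quiver)
    (ws : seq (seq (arrow Q))) : potential K Q :=
  fun c => \sum_(w <- ws) (val c == w)%:R.

End PolygonTrees.

(* Main.v *)
(* Impose on the paths of a polygon-tree quiver only the relations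
   p + q = 0 for the two complements p, q of each glued arrow, and call a path
   zero if it contains a whole polygon beginning or ending with an arrow that is
   not glued; such a path vanishes in the Jacobian algebra, because the
   complement of a non-glued arrow e is the cyclic derivative at e. Then, up to
   sign, there is at most one nonzero path between two given vertices. This goes
   by induction on the gluings. Since the new side of a glued polygon equals, up
   to sign, the complement of the glued arrow a in the old quiver, a path between
   old vertices is a path of the old quiver; and a path between new vertices that
   leaves the new side is controlled by the old paths parallel to a, which are a
   itself or zero. *)

From HB Require Import structures.
Require Import Defs.
From mathcomp Require Import all_boot all_algebra.
From mathcomp Require Import boolp.
From mathcomp Require Import zify.

Set Implicit Arguments.
Unset Strict Implicit.
Unset Printing Implicit Defensive.

Import GRing.Theory.

Local Notation linked Q := (fun e f : arrow Q => tgt e == src f).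

(** * Words in the arrows up to the relations at glued arrows *)

Section Words.
Variable Q : quiver.
Implicit Types (e : arrow Q) (w s t u v : seq (arrow Q)).
Implicit Types (ws : seq (seq (arrow Q))) (used : {set arrow Q}).

(** The rest of the polygon [w], read from [tgt e] back to [src e]; for a duplicate-free cycle [w]
    through [e] it is the cyclic derivative of [w] at [e]. *)
Definition compl e w := drop (index e w).+1 w ++ take (index e w) w.

Lemma rot_compl e w : e \in w -> rot (index e w) w = e :: compl e w.
Proof. exact: rot_index. Qed.

Lemma size_compl e w : e \in w -> (size (compl e w)).+1 = size w.
Proof. by move=> ew; rewrite -(size_rot (index e w) w) rot_compl. Qed.

Lemma cycle_compl e w : e \in w -> cycle (linked Q) w ->
  path (linked Q) e (rcons (compl e w) e).
Proof. by move=> ew; rewrite -(rot_cycle (index e w)) rot_compl. Qed.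

(* Equality up to sign modulo the relations of the glued arrows: an arrow lying
   in two different polygons is a glued one (see [good_cycles]). *)
Inductive weq ws : seq (arrow Q) -> seq (arrow Q) -> Prop :=
| weq_step e w1 w2 u v : w1 \in ws -> w2 \in ws -> e \in w1 -> e \in w2 ->
    weq ws (u ++ compl e w1 ++ v) (u ++ compl e w2 ++ v)
| weq_refl s : weq ws s s
| weq_sym s t : weq ws s t -> weq ws t s
| weq_trans s t u : weq ws s t -> weq ws t u -> weq ws s u.

Lemma weq_cat2l ws u s t : weq ws s t -> weq ws (u ++ s) (u ++ t).
Proof.
elim=> [e w1 w2 u' v w1P w2P e1 e2|{}s|{}s {}t _|{}s {}t r _ st _ tr].
- by rewrite !(catA u); apply: weq_step.
- exact: weq_refl.
- exact: weq_sym.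
- exact: weq_trans tr.
Qed.

Lemma weq_cat2r ws v s t : weq ws s t -> weq ws (s ++ v) (t ++ v).
Proof.
elim=> [e w1 w2 u v' w1P w2P e1 e2|{}s|{}s {}t _|{}s {}t r _ st _ tr].
- by rewrite -!(catA u) -!(catA _ v'); apply: weq_step.
- exact: weq_refl.
- exact: weq_sym.
- exact: weq_trans tr.
Qed.

Definition boundary_cycle ws used s :=
  exists e w, [/\ w \in ws, e \in w, e \notin used &
    s = e :: compl e w \/ s = rcons (compl e w) e].

Definition wzero ws used s :=
  exists u c v, boundary_cycle ws used c /\ weq ws s (u ++ c ++ v).

Lemma wzero_weq ws used s t : weq ws s t -> wzero ws used t -> wzero ws used s.
Proof.
by move=> st [u [c [v [cP tP]]]]; exists u, c, v; split=> //; apply: weq_trans tP.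
Qed.

Lemma wzero_cat ws used u s v : wzero ws used s -> wzero ws used (u ++ s ++ v).
Proof.
move=> [u' [c [v' [cP sP]]]]; exists (u ++ u'), c, (v' ++ v); split=> //.
have -> : (u ++ u') ++ c ++ v' ++ v = u ++ (u' ++ c ++ v') ++ v by rewrite !catA.
by apply: weq_cat2l; apply: weq_cat2r.
Qed.

(** Combinatorial form of the statement that [s] is a scalar multiple of [z] modulo the Jacobian
    ideal: the scalar is a sign in the first case and 0 in the second. *)
Definition wclass ws used s z := weq ws s z \/ wzero ws used s.

Lemma wclass_cat ws used u s z v :
  wclass ws used s z -> wclass ws used (u ++ s ++ v) (u ++ z ++ v).
Proof.
case=> [sz|s0]; [left|right].
  by apply: weq_cat2l; apply: weq_cat2r.
exact: wzero_cat.
Qed.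

Lemma wclass_weq ws used s t z :
  weq ws s t -> wclass ws used t z -> wclass ws used s z.
Proof.
move=> st [tz|t0]; [left; exact: weq_trans tz|right; exact: wzero_weq t0].
Qed.

(** The count makes the cyclic derivative at an arrow a single complement, or a sum of two if the
    arrow is glued. The bound on the size makes complements nonempty. *)
Definition good_cycles ws used :=
  (forall w, w \in ws ->
     [/\ uniq w, (1 < size w)%N & cycle (linked Q) w])
  /\ forall e, count (fun w => e \in w) ws = (e \in used).+1.

Definition one_class ws used (x y : vertex Q) z :=
  forall s, is_path x s -> path_end x s = y -> wclass ws used s z.

(* The last two conjuncts fix the representatives of the first; gluing a polygon
   at [a] needs them for [a] and for its endpoints. *)
Definition thin ws used :=
  [/\ forall x y, exists z, one_class ws used x y z,
      forall e, one_class ws used (src e) (tgt e) [:: e] &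
      forall x, one_class ws used x x [::]].

End Words.

(** * Concatenation and end points of paths *)

Lemma path_end_cat (Q : quiver) x (s t : seq (arrow Q)) :
  path_end x (s ++ t) = path_end (path_end x s) t.
Proof. by rewrite /path_end map_cat last_cat. Qed.

Lemma is_path_rcons (Q : quiver) x (s : seq (arrow Q)) e :
  is_path x (rcons s e) = is_path x s && (src e == path_end x s).
Proof. by rewrite -cats1 is_path_cat /= andbT. Qed.

Lemma path_end_rcons (Q : quiver) x (s : seq (arrow Q)) e :
  path_end x (rcons s e) = tgt e.
Proof. by rewrite -cats1 path_end_cat. Qed.

Lemma path_linked (Q : quiver) e (s : seq (arrow Q)) :
  path (linked Q) e s = is_path (tgt e) s.
Proof. by elim: s e => //= f s IHs e; rewrite IHs eq_sym. Qed.

(** * Transport of words along an injective map of quivers *)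

Section Maps.
Variables (Q Q' : quiver) (fv : vertex Q -> vertex Q') (fa : arrow Q -> arrow Q').
Hypotheses (fa_inj : injective fa) (fv_src : forall e, src (fa e) = fv (src e))
  (fv_tgt : forall e, tgt (fa e) = fv (tgt e)).

Lemma compl_map e w : compl (fa e) (map fa w) = map fa (compl e w).
Proof. by rewrite /compl index_map // map_cat map_drop map_take. Qed.

Lemma path_end_map x s : path_end (fv x) (map fa s) = fv (path_end x s).
Proof. by elim/last_ind: s => // s e _; rewrite map_rcons !path_end_rcons. Qed.

Lemma cycle_linked_map w : cycle (linked Q) w -> cycle (linked Q') (map fa w).
Proof. by apply: homo_cycle => e f /eqP; rewrite fv_src fv_tgt => ->. Qed.

Variables (ws : seq (seq (arrow Q))) (ws' : seq (seq (arrow Q'))).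
Hypothesis ws_ws' : forall w, w \in ws -> map fa w \in ws'.

Lemma weq_map s t : weq ws s t -> weq ws' (map fa s) (map fa t).
Proof.
elim=> {s t} [e w1 w2 u v w1P w2P e1 e2|s|s t _|s t r _ st _ tr].
- rewrite !(map_cat fa u) !(map_cat fa _ v) -!compl_map.
  by apply: weq_step; rewrite ?ws_ws' ?map_f.
- exact: weq_refl.
- exact: weq_sym.
- exact: weq_trans tr.
Qed.

Variables (used : {set arrow Q}) (used' : {set arrow Q'}).
Hypothesis bc_map : forall c, boundary_cycle ws used c -> wzero ws' used' (map fa c).

(** The images of boundary cycles need only be zero words: a boundary cycle at an arrow that becomes
    glued is no longer one at that arrow. *)
Lemma wclass_map s z : wclass ws used s z -> wclass ws' used' (map fa s) (map fa z).
Proof.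
case=> [/weq_map|[u [c [v [/bc_map c0 /weq_map]]]]]; first by left.
by rewrite !map_cat => sc; right; apply: (wzero_weq sc); apply: wzero_cat.
Qed.

End Maps.

(** * Invariance under isomorphism of quivers *)

Section Isomorphism.
Variables (Q Q' : quiver) (fv : vertex Q -> vertex Q') (fa : arrow Q -> arrow Q').
Hypotheses (fvB : bijective fv) (faB : bijective fa)
  (fv_src : forall e, src (fa e) = fv (src e))
  (fv_tgt : forall e, tgt (fa e) = fv (tgt e)).
Variables (ws : seq (seq (arrow Q))) (used : {set arrow Q}).
Let ws' := [seq map fa w | w <- ws].
Let used' := [set fa e | e in used].

Lemma good_cycles_iso : good_cycles ws used -> good_cycles ws' used'.
Proof.
have fa_inj := bij_inj faB; move=> [wsP wsC]; split=> [_ /mapP[w wP ->]|e'].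
  have [uw w1 wc] := wsP _ wP; rewrite map_inj_uniq // size_map; split=> //.
  exact: cycle_linked_map wc.
have [ga _ faK] := faB; rewrite -[e']faK mem_imset // -wsC count_map.
by apply: eq_count => w /=; rewrite mem_map.
Qed.

Lemma one_class_iso x y z :
  one_class ws used x y z -> one_class ws' used' (fv x) (fv y) (map fa z).
Proof.
have [fa_inj fv_inj] := (bij_inj faB, bij_inj fvB).
move=> zP s'; have [ga _ faK] := faB.
have -> : s' = map fa (map ga s') by rewrite -map_comp map_id_in // => e _ /=.
set s := map ga s'; rewrite (path_end_map fv_tgt) => s'P /fv_inj sy.
have sP : is_path x s.
  elim: s x s'P {zP sy} => //= e s IHs x /andP[].
  by rewrite fv_src fv_tgt (inj_eq fv_inj) => -> /IHs.
apply: (wclass_map fa_inj) (zP _ sP sy) => [w wP|c [e [w [wP ew eu cE]]]].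
  exact: map_f.
exists [::], (map fa c), [::]; rewrite cats0; split; last exact: weq_refl.
exists (fa e), (map fa w); rewrite map_f // mem_map // mem_imset // compl_map //.
split=> //; case: cE => ->; first by left.
by right; rewrite map_rcons.
Qed.

Lemma thin_iso : thin ws used -> thin ws' used'.
Proof.
have [gv _ fvK] := fvB; have [ga _ faK] := faB.
move=> [thz the thx]; split=> [x y|e|x].
- have [z zP] := thz (gv x) (gv y); exists (map fa z).
  by rewrite -[x]fvK -[y]fvK; apply: one_class_iso.
- rewrite -[e]faK fv_src fv_tgt -[[:: _]]/(map fa [:: ga e]).
  exact: one_class_iso.
- by rewrite -[x]fvK -[[::]]/(map fa [::]); apply: one_class_iso.
Qed.

End Isomorphism.

(** * A single polygon *)

Lemma fcycle_traject (T : eqType) (f : T -> T) x k :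
  iter k f x = x -> fcycle f (traject f x k).
Proof.
case: k => //= k kx; rewrite -[X in rcons _ X]kx -iterS iterSr -trajectSr.
exact: fpath_traject.
Qed.

Section CycleQuiver.
Variable n : nat.
Implicit Types (x y : 'I_n) (s z : seq 'I_n).
Local Notation C := (cycle_quiver n).

Lemma val_iter_ordS k x : iter k (@ordS n) x = (x + k) %% n :> nat.
Proof.
elim: k => [|k IHk]; first by rewrite addn0 modn_small.
by rewrite iterS /= IHk addnS -addn1 modnDml addn1.
Qed.

Lemma iter_ordS_n x : iter n (@ordS n) x = x.
Proof. by apply: val_inj; rewrite /= val_iter_ordS modnDr modn_small. Qed.

Lemma iter_ordS_onto x y : exists2 k, k < n & y = iter k (@ordS n) x.
Proof.
have n0 : 0 < n by case: (n) x => [[]|].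
exists ((y + (n - x)) %% n); first by rewrite ltn_mod.
apply: val_inj; rewrite /= val_iter_ordS modnDmr addnCA subnKC ?modnDr ?modn_small //.
exact: ltnW.
Qed.

Lemma iter_ordS_inj x i j : i < n -> j < n ->
  iter i (@ordS n) x = iter j (@ordS n) x -> i = j.
Proof.
move=> i_n j_n /(congr1 val) /=; rewrite !val_iter_ordS => /eqP.
by rewrite eqn_modDl !modn_small // => /eqP.
Qed.

Lemma rot_enum_ord x : rot x (enum 'I_n) = traject (@ordS n) x n.
Proof.
apply: (@eq_from_nth _ x) => [|i]; rewrite size_rot size_enum_ord ?size_traject //.
move=> i_n; rewrite nth_traject //; apply: val_inj; rewrite /= val_iter_ordS.
have xn : x < n by []; rewrite nth_cat size_drop size_enum_ord.
case: ltnP => xi.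
  by rewrite nth_drop nth_enum_ord ?modn_small //; lia.
rewrite nth_take ?nth_enum_ord; [|lia|lia].
by rewrite -[x + i](@subnK n) ?modnDr ?modn_small; lia.
Qed.

Lemma compl_enum_ord x : x :: @compl C x (enum 'I_n) = traject (@ordS n) x n.
Proof.
have xP : x \in enum 'I_n by rewrite mem_enum.
by rewrite -(rot_compl (Q := C) xP) index_enum_ord rot_enum_ord.
Qed.

Lemma cycle_enum_ord : cycle (linked C) (enum 'I_n).
Proof.
case: (posnP n) => [n0|n0]; first by case: (enum _) (size_enum_ord n); rewrite ?n0.
rewrite -(rot_cycle (Ordinal n0)) rot_enum_ord.
exact/fcycle_traject/iter_ordS_n.
Qed.

Lemma cycle_path x s : @is_path C x s ->
  s = traject (@ordS n) x (size s) /\ @path_end C x s = iter (size s) (@ordS n) x.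
Proof.
elim: s x => // y s IHs x /= /andP[/eqP <- /IHs[sE sz]].
by split; [congr cons|rewrite -iterS iterSr].
Qed.

(** In an oriented cycle the start and the length determine a path, and the end determines the
    length modulo [n]. A path of length at least [n] begins with the whole polygon, which is a
    boundary cycle since no arrow is glued yet. *)
Lemma one_class_cycle x z : @is_path C x z -> size z < n ->
  @one_class C [:: enum 'I_n] set0 x (@path_end C x z) z.
Proof.
move=> /cycle_path[zE ->] zn s /cycle_path[sE ->] sz.
have [sn|ns] := ltnP (size s) n.
  left; rewrite zE sE (iter_ordS_inj sn zn sz); exact: weq_refl.
right; rewrite sE -(subnKC ns) trajectD -compl_enum_ord.
exists [::]; eexists; eexists; split; last exact: weq_refl.
by exists x, (enum 'I_n); rewrite inE mem_enum in_set0; split=> //; left.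
Qed.

Lemma cycle_quiver_good : 1 < n -> @good_cycles C [:: enum 'I_n] set0.
Proof.
move=> n1; split=> [w|e] /=; last by rewrite mem_enum in_set0.
rewrite inE => /eqP ->; rewrite enum_uniq size_enum_ord; split=> //.
exact: cycle_enum_ord.
Qed.

Lemma cycle_quiver_thin : 1 < n -> @thin C [:: enum 'I_n] set0.
Proof.
move=> n1; have pathT k x : @is_path C x (traject (@ordS n) x k).
  by elim: k x => //= k IHk x; rewrite eqxx IHk.
split=> [x y|e|x].
- have [k kn ->] := iter_ordS_onto x y; exists (traject (@ordS n) x k).
  have [_] := cycle_path (pathT k x); rewrite size_traject => <-.
  by apply: one_class_cycle; rewrite ?size_traject.
- by apply: (@one_class_cycle e [:: e]); rewrite //= eqxx.
- by apply: (@one_class_cycle x [::]); rewrite //= ltnW.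
Qed.

End CycleQuiver.

Section Gluing.
Variables (Q : quiver) (ws : seq (seq (arrow Q))) (used : {set arrow Q}).
Variables (a : arrow Q) (n : nat) (b : 'I_n).
Hypotheses (gd : good_cycles ws used) (th : thin ws used).
Hypotheses (a_unused : a \notin used) (n_gt2 : 2 < n).

Local Notation C := (cycle_quiver n).
Local Notation G := (@glue Q a C b).
Local Notation inL := (@glue_inl Q a C b).
Local Notation inR := (@glue_inr Q a C b).
Local Notation vL := (inl : vertex Q -> vertex G).
Local Notation vR := (@glue_vertex Q a C b : 'I_n -> vertex G).
Let wC : seq (arrow G) := map inR (enum 'I_n).
Let ws' := rcons [seq map inL w | w <- ws] wC.
Let used' : {set arrow G} := inL a |: [set inL e | e in used].

Let inL_inj : injective inL. Proof. by move=> e f []. Qed.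

Let n_gt1 : 1 < n. Proof. exact: ltnW. Qed.
Let n_gt0 : 0 < n. Proof. exact: ltnW. Qed.

Let ordS_b : @ordS n b != b.
Proof. by apply/eqP => /(@iter_ordS_inj _ b 1 0 n_gt1 n_gt0). Qed.

Lemma glue_inr_b : inR b = inL a.
Proof. by rewrite /glue_inr /glue_arrow insubF // eqxx. Qed.

Lemma glue_vertex_b : vR b = vL (src a).
Proof. by rewrite /glue_vertex insubF /= eqxx. Qed.

Lemma glue_vertex_tgt_b : vR (ordS b) = vL (tgt a).
Proof. by rewrite /glue_vertex insubF /= ?eqxx ?andbF // (negPf ordS_b). Qed.

Lemma glue_inr_src e : src (inR e) = vR e.
Proof.
have [->|eb] := eqVneq e b; first by rewrite glue_inr_b glue_vertex_b.
by rewrite /glue_inr /glue_arrow insubT.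
Qed.

Lemma glue_inr_tgt e : tgt (inR e) = vR (ordS e).
Proof.
have [->|eb] := eqVneq e b; first by rewrite glue_inr_b glue_vertex_tgt_b.
by rewrite /glue_inr /glue_arrow insubT.
Qed.

Lemma glue_inr_inj : injective inR.
Proof.
move=> e f; rewrite /glue_inr /glue_arrow.
by case: insubP => [e' _ <-|/negPn/eqP->]; case: insubP => [f' _ <-|/negPn/eqP->] // [->].
Qed.

(* [beta 0] is the glued arrow; [beta 1], ..., [beta n.-1] are the new ones. *)
Let beta i : arrow G := inR (iter i (@ordS n) b).
(** The vertices [nu 0] and [nu 1] are the ends of [a], and the new vertices are the [nu i] with
    [1 < i < n]. Indices matter only modulo [n] and are left unreduced, so that a segment may run
    past [nu n]. *)
Let nu i : vertex G := vR (iter i (@ordS n) b).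
Let seg i k : seq (arrow G) := map inR (traject (@ordS n) (iter i (@ordS n) b) k).

Lemma beta_src i : src (beta i) = nu i. Proof. exact: glue_inr_src. Qed.
Lemma beta_tgt i : tgt (beta i) = nu i.+1. Proof. exact: glue_inr_tgt. Qed.
Lemma beta0 : beta 0 = inL a. Proof. exact: glue_inr_b. Qed.
Lemma nu0 : nu 0 = vL (src a). Proof. exact: glue_vertex_b. Qed.
Lemma nu1 : nu 1 = vL (tgt a). Proof. exact: glue_vertex_tgt_b. Qed.
Lemma nun : nu n = nu 0. Proof. by rewrite /nu iter_ordS_n. Qed.

Lemma segS i k : seg i k.+1 = beta i :: seg i.+1 k.
Proof. by rewrite /seg trajectS. Qed.

Lemma segSr i k : seg i k.+1 = rcons (seg i k) (beta (i + k)).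
Proof. by rewrite /seg trajectSr map_rcons /beta addnC iterD. Qed.

Lemma segD i k l : seg i (k + l) = seg i k ++ seg (i + k) l.
Proof. by rewrite /seg trajectD map_cat addnC iterD. Qed.

Lemma seg_n k : seg n k = seg 0 k. Proof. by rewrite /seg iter_ordS_n. Qed.

Lemma compl_wC i : beta i :: compl (beta i) wC = seg i n.
Proof. by rewrite (compl_map glue_inr_inj) /seg -compl_enum_ord. Qed.

Lemma compl_beta i : compl (beta i) wC = seg i.+1 n.-1.
Proof. by have := compl_wC i; rewrite -[X in seg _ X](prednK n_gt0) segS => -[]. Qed.

Lemma seg_nE i : seg i n = beta i :: seg i.+1 n.-1.
Proof. by rewrite -compl_beta compl_wC. Qed.

Lemma seg_nEr i : seg i n = rcons (seg i n.-1) (beta (i + n.-1)).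
Proof. by rewrite -segSr prednK. Qed.

Lemma beta_wC i : beta i \in wC.
Proof. by apply: map_f; rewrite mem_enum. Qed.

Lemma wC_ws' : wC \in ws'. Proof. by rewrite mem_rcons mem_head. Qed.

Lemma ws_ws' w : w \in ws -> map inL w \in ws'.
Proof. by move=> wP; rewrite mem_rcons in_cons map_f ?orbT. Qed.

Lemma inr_cases (e : {e : arrow C | e != b}) :
  exists2 i, 0 < i < n & (inr e : arrow G) = beta i.
Proof.
have [[|i] i_n eE] := iter_ordS_onto b (val e); first by case/eqP: (valP e).
exists i.+1; rewrite ?i_n // /beta -eE /glue_inr /glue_arrow.
by rewrite valK.
Qed.

Lemma vertex_cases (v : vertex G) :
  (exists y, v = vL y) \/ exists2 i, 1 < i < n & v = nu i.
Proof.
case: v => [y|v]; [by left; exists y|right].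
have [i i_n vE] := iter_ordS_onto b (val v).
exists i; last by rewrite /nu -vE /glue_vertex valK.
have /andP[/eqP v0 /eqP v1] := valP v.
by case: i i_n vE => [|[|i]] i_n vE; [case: v0|case: v1|rewrite i_n].
Qed.

Lemma nu_inr i : 1 < i < n -> exists2 v, nu i = inr v & val v = iter i (@ordS n) b.
Proof.
move=> /andP[i1 i_n]; rewrite /nu /glue_vertex.
case: insubP => [v _ vE|]; first by exists v.
rewrite negb_and !negbK => /orP[]/eqP.
  by move/(@iter_ordS_inj _ b i 0 i_n n_gt0) => i0; rewrite i0 in i1.
by move/(@iter_ordS_inj _ b i 1 i_n n_gt1) => i0; rewrite i0 in i1.
Qed.

Lemma nu_neq_old i y : 1 < i < n -> nu i <> vL y.
Proof. by move=> /nu_inr[v ->]. Qed.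

Lemma nu_inj i j : 1 < i < n -> 1 < j < n -> nu i = nu j -> i = j.
Proof.
move=> ip jp; have [v -> vE] := nu_inr ip; have [v' -> v'E] := nu_inr jp.
move=> [vv']; apply: (@iter_ordS_inj _ b); [lia|lia|].
by rewrite -vE -v'E vv'.
Qed.

Lemma beta_used' i : 0 < i < n -> beta i \notin used'.
Proof.
move=> /andP[i0 i_n].
have : iter i (@ordS n) b != b.
  by apply/eqP => /(@iter_ordS_inj _ b i 0 i_n n_gt0) i0E; rewrite i0E in i0.
rewrite /beta /glue_inr /glue_arrow => ib; rewrite insubT in_setU1 negb_or /=.
by apply/imsetP => -[].
Qed.

Lemma seg_n_boundary i : 0 < i < n -> boundary_cycle ws' used' (seg i n).
Proof.
move=> ip; exists (beta i), wC; rewrite wC_ws' beta_wC beta_used' //.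
by split=> //; left; rewrite compl_wC.
Qed.

(** Among the old arrows only [a] lies on the new polygon, and [a] is also the only old arrow that
    becomes used; a new arrow lies on the new polygon alone. *)
Lemma glue_good : good_cycles ws' used'.
Proof.
split=> [w|e].
  rewrite mem_rcons in_cons => /orP[/eqP->|/mapP[w0 /gd.1[uw w1 wc] ->]].
    rewrite size_map size_enum_ord map_inj_uniq ?enum_uniq; last exact: glue_inr_inj.
    split=> //; apply: cycle_linked_map glue_inr_src glue_inr_tgt _ _.
    exact: cycle_enum_ord.
  by rewrite map_inj_uniq // size_map; split=> //; apply: (cycle_linked_map (fv := vL)) wc.
rewrite /ws' -cats1 count_cat count_map /= addn0; case: e => [e|e]; last first.
  rewrite (@eq_count _ _ pred0) ?count_pred0 => [|w /=]; last by apply/mapP => -[].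
  by have [i ip ->] := inr_cases e; rewrite beta_wC (negPf (beta_used' ip)).
rewrite -[inl e]/(inL e) (@eq_count _ _ (fun w => e \in w)); last first.
  by move=> w /=; rewrite mem_map.
rewrite gd.2 in_setU1 mem_imset // (inj_eq inL_inj).
have -> : (inL e \in wC) = (e == a).
  apply/mapP/eqP => [[c _]|->]; last by exists b; rewrite ?mem_enum ?glue_inr_b.
  rewrite /glue_inr /glue_arrow; case: insubP => //= _ [->] //.
by case: eqP => [->|_]; [rewrite (negPf a_unused)|rewrite addn0].
Qed.

(** * Comparison of words of the old and the glued quiver *)

Let wa_ex : exists2 w, w \in ws & a \in w.
Proof. by apply/hasP; rewrite has_count gd.2. Qed.

(** Both sides are complements of [a], one in the new polygon and one in [w]. *)
Lemma seg_old w : w \in ws -> a \in w -> weq ws' (seg 1 n.-1) (map inL (compl a w)).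
Proof.
move=> wP aw; rewrite -(compl_map inL_inj) -beta0 -compl_beta.
rewrite -[X in weq _ X]cats0 -[X in weq _ _ X]cats0; apply: (@weq_step _ _ _ _ _ [::]).
- exact: wC_ws'.
- exact: ws_ws'.
- exact: beta_wC.
- by rewrite beta0 map_f.
Qed.

(** Only the cycles at [a] are affected. There the complement of [a] can be replaced by the new
    side, which turns the cycle into the new polygon; it then ends with [beta n.-1] or begins with
    [beta 1], and both are unglued. *)
Lemma boundary_cycle_old c :
  boundary_cycle ws used c -> wzero ws' used' (map inL c).
Proof.
move=> [e [w [wP ew eu cE]]]; have [ea|ea] := eqVneq e a; last first.
  exists [::], (map inL c), [::]; rewrite cats0; split; last exact: weq_refl.
  exists (inL e), (map inL w); rewrite ws_ws' // map_f // in_setU1 mem_imset //.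
  rewrite (inj_eq inL_inj) negb_or ea compl_map //; split=> //.
  by case: cE => ->; [left|right; rewrite map_rcons].
have nK : n.-1.+1 = n by exact: prednK.
rewrite ea in ew cE; have wq := weq_sym (seg_old wP ew).
case: cE => ->.
  exists [::], (seg 0 n), [::]; split.
    exists (beta n.-1), wC; rewrite wC_ws' beta_wC beta_used'; last lia.
    by split=> //; right; rewrite compl_beta nK seg_n seg_nEr.
  rewrite cats0 /= -beta0 seg_nE; exact: (weq_cat2l [:: beta 0]).
exists [::], (seg 1 n), [::]; split; first by apply: seg_n_boundary; lia.
rewrite cats0 map_rcons seg_nEr add1n nK.
have -> : beta n = inL a by rewrite -beta0 /beta iter_ordS_n.
by rewrite -!cats1; apply: weq_cat2r.
Qed.

Let wclass_old s z : wclass ws used s z -> wclass ws' used' (map inL s) (map inL z).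
Proof. exact: (wclass_map inL_inj ws_ws' boundary_cycle_old). Qed.

(** By induction on the last arrow: the new side is entered only at [tgt a] and left only at its far
    end, and once completely traversed it is exchanged for an old complement of [a]. *)
Lemma path_from_old x s : is_path (vL x) s -> exists s0, is_path x s0 /\
  (path_end (vL x) s = vL (path_end x s0) /\ weq ws' s (map inL s0) \/
   exists i, [/\ 1 < i < n, path_end (vL x) s = nu i, path_end x s0 = tgt a &
     weq ws' s (map inL s0 ++ seg 1 i.-1)]).
Proof.
elim/last_ind: s => [_|s e IHs].
  by exists [::]; split=> //; left; split=> //; apply: weq_refl.
rewrite is_path_rcons path_end_rcons => /andP[/IHs[s0 [s0P sE]] /eqP es].
have tail t : weq ws' s t -> weq ws' (rcons s e) (rcons t e).
  by move=> st; rewrite -!cats1; apply: weq_cat2r.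
case: sE => [[sv sw]|[i [ip sv s0a sw]]].
  rewrite sv in es; case: e es tail => [e [es]|e es] tail.
    exists (rcons s0 e); rewrite is_path_rcons s0P es eqxx path_end_rcons; split=> //.
    by left; split=> //; rewrite map_rcons; apply: tail.
  have [i ip eE] := inr_cases e; rewrite eE in es tail *; rewrite beta_src in es.
  (* Every new arrow other than [beta 1] starts at a new vertex, so the path now ends at [nu 2]. *)
  have i1 : i = 1.
    apply/eqP/negPn/negP => i1; apply: (@nu_neq_old i (path_end x s0) _ es); lia.
  exists s0; split=> //; right; exists 2; rewrite i1 in es tail *.
  rewrite beta_tgt; split=> //; first by move: es; rewrite nu1 => -[].
  by rewrite (segS 1 0) cats1; apply: tail.
rewrite sv in es; case: e es tail => [e es|e].
  by case: (nu_neq_old ip (esym es)).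
have [j jp ->] := inr_cases e; rewrite beta_src beta_tgt => nuj tail.
have ji : j = i.
  apply: nu_inj => //; apply/andP; split; last lia.
  rewrite ltn_neqAle; case/andP: jp => -> _; rewrite andbT.
  by apply/eqP => j1; apply: (nu_neq_old ip); rewrite -nuj -j1 nu1.
rewrite {j}ji in jp nuj tail *.
have sE : weq ws' (rcons s (beta i)) (map inL s0 ++ seg 1 i).
  have -> : seg 1 i = rcons (seg 1 i.-1) (beta i).
    by case: (i) ip => // k _; rewrite segSr.
  by rewrite -rcons_cat; apply: tail.
have [i_n|ni] := ltnP i.+1 n.
  by exists s0; split=> //; right; exists i.+1; split=> //; lia.
(* Here [beta i] completes the new side, and an old polygon through [a] supplies the replacement,
   which ends at [src a]. *)
have iE : i.+1 = n by lia.
have [w wP aw] := wa_ex.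
have [_ _ /(cycle_compl aw)] := gd.1 _ wP.
rewrite path_linked is_path_rcons => /andP[cP /eqP cE].
exists (s0 ++ compl a w); rewrite is_path_cat s0P s0a cP path_end_cat s0a -cE.
split=> //; left; rewrite iE nun nu0; split=> //; apply: weq_trans sE _.
rewrite map_cat; have -> : i = n.-1 by rewrite -iE.
exact/weq_cat2l/seg_old.
Qed.

Lemma path_end_chain i : 1 < i < n -> path_end (nu i) (seg i (n - i)) = nu 0.
Proof.
move=> ip; have -> : n - i = (n - i).-1.+1 by lia.
by rewrite segSr path_end_rcons beta_tgt -nun; congr nu; lia.
Qed.

(** Only one arrow leaves each new vertex, so there is no choice before [nu 0], the source of [a],
    is reached. *)
Lemma path_from_new i s : 1 < i < n -> is_path (nu i) s ->
  (exists k, [/\ i + k < n, path_end (nu i) s = nu (i + k) & s = seg i k]) \/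
  exists s1, s = seg i (n - i) ++ s1 /\ is_path (nu 0) s1.
Proof.
move=> ip; elim/last_ind: s => [_|s e IHs].
  by left; exists 0; rewrite addn0; case/andP: ip.
rewrite is_path_rcons path_end_rcons => /andP[sP /eqP es].
case: (IHs sP) => [[k [ik sv sE]]|[s1 [sE s1P]]]; last first.
  right; exists (rcons s1 e); rewrite sE rcons_cat is_path_rcons s1P es sE path_end_cat.
  by split=> //; rewrite path_end_chain ?eqxx.
rewrite sv in es; case: e es => [e es|e].
  by case: (@nu_neq_old (i + k) (src e)) => //; lia.
have [j jp ->] := inr_cases e; rewrite beta_src beta_tgt => nuj.
have ji : j = i + k.
  apply: nu_inj; [|lia|by []]; apply/andP; split; last lia.
  rewrite ltn_neqAle; case/andP: jp => -> _; rewrite andbT; apply/eqP => j1.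
  by apply: (@nu_neq_old (i + k) (tgt a)); [lia|rewrite -nuj -j1 nu1].
rewrite ji sE -segSr -addnS.
have [i_n|ni] := ltnP (i + k.+1) n; first by left; exists k.+1.
right; exists [::]; split=> //; rewrite cats0; congr seg; lia.
Qed.

(** * One class for each pair of vertices of the glued quiver *)

Let wclass_catl u s z : wclass ws' used' s z -> wclass ws' used' (u ++ s) (u ++ z).
Proof. by move/(wclass_cat u [::]); rewrite !cats0. Qed.

Let wclass_catr v s z : wclass ws' used' s z -> wclass ws' used' (s ++ v) (z ++ v).
Proof. by move/(wclass_cat [::] v). Qed.

Lemma one_class_old_old x y z : one_class ws used x y z ->
  one_class ws' used' (vL x) (vL y) (map inL z).
Proof.
move=> zP s /path_from_old[s0 [s0P [[-> sw] [sy]|[i [ip -> _ _]]]]].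
  exact/(wclass_weq sw)/wclass_old/zP.
by move/(nu_neq_old ip).
Qed.

Lemma one_class_old_new x i z : 1 < i < n -> one_class ws used x (tgt a) z ->
  one_class ws' used' (vL x) (nu i) (map inL z ++ seg 1 i.-1).
Proof.
move=> ip zP s /path_from_old[s0 [s0P [[-> _] /esym/(nu_neq_old ip) //|]]].
move=> [j [jp -> s0a sw] /(nu_inj jp ip) ji]; rewrite {j}ji in jp sw.
exact/(wclass_weq sw)/wclass_catr/wclass_old/zP.
Qed.

Lemma one_class_new_old i y z : 1 < i < n -> one_class ws used (src a) y z ->
  one_class ws' used' (nu i) (vL y) (seg i (n - i) ++ map inL z).
Proof.
move=> ip zP s /(path_from_new ip)[[k [ik -> _]]|[s1 [sE s1P]]].
  by move/nu_neq_old => h; case: h; lia.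
rewrite sE path_end_cat path_end_chain // => s1y; rewrite nu0 in s1P s1y.
exact/wclass_catl/(one_class_old_old zP).
Qed.

(** A path that leaves the new side does so at [src a] and comes back at [tgt a]; by thinness its
    old part is [a] or zero. If it is [a], the path is equivalent to a run around the polygon, and
    when [i <= j] this run begins with all of [seg i n] and is zero, which leaves the direct
    segment. *)
Lemma one_class_new_new i j : 1 < i < n -> 1 < j < n ->
  one_class ws' used' (nu i) (nu j) (if i <= j then seg i (j - i) else seg i (n - i + j)).
Proof.
move=> ip jp s /(path_from_new ip)[[k [ik -> sE]]|[s1 [sE s1P]]].
  move=> ikj; have ijE : i + k = j by apply: nu_inj ikj => //; lia.
  rewrite sE -ijE leq_addr addKn; left; exact: weq_refl.
rewrite sE path_end_cat path_end_chain // => s1j; rewrite nu0 in s1P s1j.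
have [_ tha _] := th.
have := one_class_old_new jp (tha a) s1P s1j; rewrite /= -beta0.
have -> : beta 0 :: seg 1 j.-1 = seg n j.
  by rewrite seg_n -segS; case: (j) jp.
move/(wclass_catl (seg i (n - i))).
have -> : seg i (n - i) ++ seg n j = seg i (n - i + j).
  by rewrite segD; congr (_ ++ seg _ _); lia.
case: leqP => // ij; case=> [sw|]; last by right.
right; apply: (wzero_weq sw); exists [::], (seg i n), (seg i (j - i)); split.
  by apply: seg_n_boundary; lia.
have -> : n - i + j = n + (j - i) by lia.
by rewrite segD /seg iterD iter_ordS_n; apply: weq_refl.
Qed.

Lemma glue_thin : thin ws' used'.
Proof.
have [thz tha th1] := th.
split=> [x y|e|x].
- case: (vertex_cases x) => [[{}x ->]|[i ip ->]];
    case: (vertex_cases y) => [[{}y ->]|[j jp ->]].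
  + by have [z /one_class_old_old zP] := thz x y; eexists; exact: zP.
  + by have [z /(one_class_old_new jp) zP] := thz x (tgt a); eexists; exact: zP.
  + by have [z /(one_class_new_old ip) zP] := thz (src a) y; eexists; exact: zP.
  + by eexists; exact: one_class_new_new ip jp.
- case: e => [e|e]; first exact: one_class_old_old (tha e).
  have [i ip ->] := inr_cases e; rewrite beta_src beta_tgt.
  (* The first new arrow starts at the old vertex [tgt a] and the last one ends at [src a]; all
     others join two new vertices. *)
  have [i1|i1] := eqVneq i 1.
    rewrite i1 nu1.
    by have := @one_class_old_new (tgt a) 2 [::] _ (th1 (tgt a)); apply; lia.
  have [i_n|ni] := ltnP i.+1 n.
    have := @one_class_new_new i i.+1; rewrite leqnSn subSnn; apply; lia.
  have -> : i.+1 = n by lia.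
  rewrite nun nu0.
  have i2 : 1 < i < n by lia.
  have := one_class_new_old i2 (th1 (src a)); rewrite cats0.
  by have -> : n - i = 1 by lia.
- case: (vertex_cases x) => [[{}x ->]|[i ip ->]]; first exact: one_class_old_old (th1 x).
  by have := one_class_new_new ip ip; rewrite leqnn subnn.
Qed.

End Gluing.

Local Open Scope ring_scope.

(** * Words as elements of the complete path algebra *)

Section WordElements.
Variables (K : fieldType) (Q : quiver).
Local Notation A := (cpathalg K Q).
Local Notation idem i := (path_elt K i [::]).

(** No start vertex is recorded, unlike in [path_elt]: the empty word gives the unit, a nonempty
    word gives its path or 0, and concatenation becomes the product. *)
Definition word_elt (s : seq (arrow Q)) : A := fun p => (arrows p == s)%:R.

Lemma word_elt_cat s t : word_elt (s ++ t) = word_elt s * word_elt t.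
Proof.
apply: cpaP => p; rewrite cpaM /word_elt.
case: eqP => [pst|nst].
  have sp : (size s < (plen p).+1)%N by rewrite ltnS /plen pst size_cat leq_addr.
  rewrite (bigD1 (Ordinal sp)) //= /arrows /= -/(arrows p) pst.
  rewrite take_size_cat // drop_size_cat // !eqxx mulr1 big1 ?addr0 // => i.
  rewrite -val_eqE /= => ni; case: eqP => [|_]; last by rewrite mul0r.
  have ip : (i <= size (s ++ t))%N by rewrite -pst -ltnS.
  by move/(congr1 size); rewrite size_takel // => /eqP; rewrite (negPf ni).
rewrite big1 // => i _; rewrite /arrows /= -/(arrows p).
case: eqP => [h1|_]; last by rewrite mul0r.
case: eqP => [h2|_]; last by rewrite mulr0.
by case: nst; rewrite -h1 -h2 cat_take_drop.
Qed.

Lemma idem_mul i (f : A) p : (idem i * f) p = ((val p).1 == i)%:R * f p.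
Proof.
rewrite cpaM big_ord_recl big1 ?addr0 => [|k _].
  by rewrite pdrop0 /path_elt /= take0 xpair_eqE eqxx andbT.
rewrite /path_elt /= xpair_eqE -size_eq0 size_takel ?andbF ?mul0r //.
Qed.

Lemma mul_idem j (f : A) p :
  (f * idem j) p = f p * (path_end (val p).1 (arrows p) == j)%:R.
Proof.
rewrite cpaM big_ord_recr big1 ?add0r => [|k _] /=.
  rewrite ptake_len /path_elt /= /plen take_size drop_size.
  by rewrite xpair_eqE eqxx andbT add0r.
rewrite /path_elt /= xpair_eqE -size_eq0 size_drop subn_eq0.
by rewrite leqNgt ltn_ord andbF mulr0.
Qed.

Lemma path_eltE i s : path_elt K i s = idem i * word_elt s.
Proof.
apply: cpaP => -[[x t] xt]; rewrite idem_mul -natrM mulnb.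
by rewrite /path_elt /= xpair_eqE.
Qed.

End WordElements.

(** * Cyclic derivatives of the polygon potential *)

Section Derivatives.
Variables (K : fieldType) (Q : quiver).
Local Notation A := (cpathalg K Q).
Local Notation idem i := (path_elt K i [::]).
Implicit Types (e : arrow Q) (w : seq (arrow Q)).
Local Notation word_elt := (@word_elt K Q).

Lemma cder_cycle_uniq e w : uniq w ->
  cder_cycle K e w = if e \in w then path_elt K (tgt e) (compl e w) else 0.
Proof.
move=> uw; rewrite /cder_cycle; case: ifP => ew; last first.
  apply: big_pred0 => i; apply: contraFF ew => /eqP wi.
  by rewrite -(onth_nth e e w i wi) mem_nth.
have iw : (index e w < size w)%N by rewrite index_mem.
rewrite (big_pred1 (Ordinal iw)) // => i; apply/eqP/eqP => [wi|-> /=].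
  by apply: val_inj; rewrite /= -(onth_nth e e w i wi) index_uniq.
by rewrite onthE (nth_map e) // nth_index.
Qed.

(** At a path of length l, [cder] sees only the polygons of length l + 1; the others contribute
    nothing there on the right either, since deriving shortens a word by exactly one arrow. *)
Lemma cder_polygon_potential ws e :
  (forall w, w \in ws -> is_cyclic w) ->
  cder (polygon_potential K ws) e = \sum_(w <- ws) cder_cycle K e w.
Proof.
move=> wsC; apply: cpaP => p; rewrite /cder.
have -> : (\sum_(w <- ws) cder_cycle K e w) p = \sum_(w <- ws) cder_cycle K e w p.
  by elim/big_rec2: _ => // w x y _ <-; rewrite cpaD.
have cW c : coefW (polygon_potential K ws) c = \sum_(w <- ws) (c == w)%:R.
  rewrite /coefW; case: insubP => [c' _ <- //|cN].
  rewrite big_seq big1 // => w /wsC wC.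
  by case: eqP cN => // ->; rewrite wC.
under eq_bigr do rewrite cW mulr_suml.
rewrite exchange_big /= big_seq [RHS]big_seq; apply: eq_bigr => w wP.
have [sw|sw] := eqVneq (size w) (plen p).+1.
  rewrite (bigD1 (tcast sw (in_tuple w))) //= val_tcast eqxx mul1r big1 ?addr0 //.
  move=> c; rewrite -val_eqE /= val_tcast /= => /negPf ->.
  by rewrite mul0r.
rewrite big1 => [|c _]; last first.
  case: eqP => [cw|_]; last by rewrite mul0r.
  by rewrite -cw size_tuple eqxx in sw.
rewrite /cder_cycle; symmetry.
elim/big_ind: _ => [||i wi]; first by rewrite cpa0.
  by move=> f g f0 g0; rewrite cpaD f0 g0 addr0.
rewrite /path_elt; case: eqP => // pE; case/negP: sw.
rewrite /plen /arrows pE /= size_cat size_drop size_takel; last exact: ltnW.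
by rewrite -addSn -subSn // subSS subnK // ltnW.
Qed.

(** The complement is nonempty, so its first arrow already fixes the start vertex. *)
Lemma idem_word_compl e w : (1 < size w)%N -> e \in w -> cycle (linked Q) w ->
  idem (tgt e) * word_elt (compl e w) = word_elt (compl e w).
Proof.
move=> w1 ew /(cycle_compl ew); have := size_compl ew.
case: (compl e w) => [sw|c t _ /= /andP[/eqP ec _]]; first by rewrite -sw in w1.
apply: cpaP => -[[x s] /= xs]; rewrite idem_mul /word_elt /arrows /=.
case: (s =P _) xs => [-> /= /andP[/eqP <- _]|]; last by rewrite mulr0.
by rewrite ec eqxx mul1r.
Qed.

Lemma cder_good ws used e : good_cycles ws used ->
  cder (polygon_potential K ws) e = \sum_(w <- ws | e \in w) word_elt (compl e w).
Proof.
move=> [wsP _]; rewrite cder_polygon_potential; last first.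
  move=> w /wsP[_ w1 wc]; rewrite /is_cyclic wc andbT.
  by case: (w) w1.
rewrite big_seq [RHS]big_mkcond [RHS]big_seq; apply: eq_bigr => w /wsP[uw w1 wc].
rewrite cder_cycle_uniq //; case: ifP => // ew.
by rewrite path_eltE idem_word_compl.
Qed.

Lemma cder_unused ws used e w : good_cycles ws used -> e \notin used ->
  w \in ws -> e \in w -> cder (polygon_potential K ws) e = word_elt (compl e w).
Proof.
move=> gd eu wP ew; rewrite (cder_good _ gd) -big_filter.
have := gd.2 e; rewrite (negPf eu) -size_filter.
have : w \in [seq w <- ws | e \in w] by rewrite mem_filter ew.
by case: filter => [//|w' [|//]]; rewrite mem_seq1 => /eqP <- _; rewrite big_seq1.
Qed.

Lemma cder_used ws used e w1 w2 : good_cycles ws used ->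
  w1 \in ws -> e \in w1 -> w2 \in ws -> e \in w2 -> w1 != w2 ->
  cder (polygon_potential K ws) e = word_elt (compl e w1) + word_elt (compl e w2).
Proof.
move=> gd w1P ew1 w2P ew2 w12; rewrite (cder_good _ gd) -big_filter.
have := gd.2 e; rewrite -size_filter.
have : w1 \in [seq w <- ws | e \in w] by rewrite mem_filter ew1.
have : w2 \in [seq w <- ws | e \in w] by rewrite mem_filter ew2.
case: filter => [//|v1 [|v2 [|v3 t]]]; last by case: (e \in used).
  by rewrite !mem_seq1 => /eqP v2E /eqP v1E; rewrite v1E v2E eqxx in w12.
rewrite !inE => h2 h1 _; rewrite big_cons big_seq1.
by case/orP: h1 h2 w12 => /eqP <- /orP[]/eqP <-; rewrite ?eqxx // addrC.
Qed.

Local Notation I ws := (cder_ideal (polygon_potential K ws)).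

Lemma cder_ideal_cder (W : potential K Q) e : cder_ideal W (cder W e).
Proof. by exists [:: (1, e, 1)]; rewrite big_seq1 mul1r mulr1. Qed.

Lemma cder_idealZ (W : potential K Q) (c : K) (x : A) :
  cder_ideal W x -> cder_ideal W (c *: x).
Proof. by move=> xW; rewrite -[x]mul1r cpa_scaleAl; apply: cder_idealMl. Qed.

(** A step between two different polygons changes the sign, because the sum of the two complements
    is the derivative at the shared arrow. Signs multiply along a chain of steps. *)
Lemma weq_word_elt ws used s t : good_cycles ws used -> weq ws s t ->
  exists b : bool, I ws (word_elt s - (-1) ^+ b *: word_elt t).
Proof.
move=> gd; elim=> {s t} [e w1 w2 u v w1P w2P ew1 ew2|s|s t _ [b sb]
  |s t r _ [b sb] _ [c tc]].
- have [<-|w12] := eqVneq w1 w2.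
    exists false; rewrite scale1r subrr; exact: cder_ideal0.
  exists true; rewrite scaleN1r opprK !(word_elt_cat _ u) !(word_elt_cat _ _ v).
  rewrite -mulrDr -mulrDl.
  apply: cder_idealMl; apply: cder_idealMr.
  by rewrite -(cder_used gd w1P ew1 w2P ew2 w12); apply: cder_ideal_cder.
- exists false; rewrite scale1r subrr; exact: cder_ideal0.
- exists b.
  have -> : word_elt t - (-1) ^+ b *: word_elt s =
      (- (-1) ^+ b) *: (word_elt s - (-1) ^+ b *: word_elt t).
    by rewrite scaleNr scalerBr scalerA -signr_addb addbb scale1r opprB.
  exact: cder_idealZ.
- exists (b (+) c).
  have -> : word_elt s - (-1) ^+ (b (+) c) *: word_elt r =
      (word_elt s - (-1) ^+ b *: word_elt t) +
      (-1) ^+ b *: (word_elt t - (-1) ^+ c *: word_elt r).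
    rewrite scalerBr scalerA signr_addb addrA.
    by rewrite subrK.
  by apply: cder_idealD => //; apply: cder_idealZ.
Qed.

Lemma boundary_cycle_word_elt ws used c : good_cycles ws used ->
  boundary_cycle ws used c -> I ws (word_elt c).
Proof.
move=> gd [e [w [wP ew eu [->|->]]]].
  rewrite -cat1s word_elt_cat; apply: cder_idealMl.
  by rewrite -(cder_unused gd eu wP ew); apply: cder_ideal_cder.
rewrite -cats1 word_elt_cat; apply: cder_idealMr.
by rewrite -(cder_unused gd eu wP ew); apply: cder_ideal_cder.
Qed.

Lemma wzero_word_elt ws used s : good_cycles ws used ->
  wzero ws used s -> I ws (word_elt s).
Proof.
move=> gd [u [c [v [cP /(weq_word_elt gd)[b sb]]]]].
rewrite -[word_elt s](subrK ((-1) ^+ b *: word_elt (u ++ c ++ v))).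
apply: cder_idealD => //; rewrite !word_elt_cat.
apply: cder_idealZ; apply: cder_idealMl; apply: cder_idealMr.
exact: boundary_cycle_word_elt gd cP.
Qed.

Lemma wclass_word_elt ws used s z : good_cycles ws used -> wclass ws used s z ->
  exists c : K, I ws (word_elt s - c *: word_elt z).
Proof.
move=> gd [/(weq_word_elt gd)[b sz]|s0]; first by exists ((-1) ^+ b).
by exists 0; rewrite scale0r subr0; apply: wzero_word_elt s0.
Qed.

End Derivatives.

(** * The spaces between two idempotents of the Jacobian algebra are at most lines *)

Section ThinQuotient.
Variables (K : fieldType) (Q : quiver).
Local Notation A := (cpathalg K Q).
Local Notation idem i := (path_elt K i [::]).
Local Notation word_elt := (@word_elt K Q).

Lemma val_qpath_eq (p : qpath Q) i s :
  (val p == (i, s)) = ((val p).1 == i) && (arrows p == s).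
Proof. by rewrite /arrows; case: (val p) => x t; rewrite xpair_eqE. Qed.

Lemma idem_idem (i : vertex Q) : idem i * idem i = idem i.
Proof.
apply: cpaP => p; rewrite idem_mul /path_elt val_qpath_eq.
by case: eqP; rewrite ?mul1r // mul0r.
Qed.

Lemma cpa_sumE (T : Type) (r : seq T) (F : T -> A) p :
  (\sum_(t <- r) F t) p = \sum_(t <- r) F t p.
Proof. exact: (big_morph (fun f : A => f p)). Qed.

(* A scalar that works modulo one power of the arrow ideal in which [z] is
   nonzero works modulo all of them. *)
Lemma madic_closure_line (W : potential K Q) (z x : A) :
  (forall n, exists c y, cder_ideal W y /\
     forall p, (plen p < n)%N -> x p = (c *: z + y) p) ->
  exists c, x - c *: z \in jac_ideal W.
Proof.
(* If [z] lies in the closure, so does [x], and the scalar 0 works. *)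
move=> xz; case: (pselect (madic_closure (cder_ideal W) z)) => [zW|/existsNP[m zm]].
  exists 0; rewrite scale0r subr0; apply/jac_idealP => n.
  have [c [y [yW xy]]] := xz n; have [y' y'W zy] := zW n.
  exists (c *: y' + y); first by apply: cder_idealD => //; apply: cder_idealZ.
  by move=> p pn; rewrite xy // !cpaD !cpaZ zy.
have [c [y [yW xy]]] := xz m; exists c; apply/jac_idealP => n.
(* The maximum allows comparison with [x] up to order [n] and with the earlier expression up to
   order [m]. *)
have [c' [y' [y'W xy']]] := xz (maxn n m).
have [cc'|cc'] := eqVneq c' c.
  exists y' => // p pn; rewrite cpaD cpaN xy' ?leq_max ?pn //.
  by rewrite cpaD cc' addrC addKr.
(* Subtracting the two expressions of [x] shows that [(c' - c) *: z] agrees with [y - y'] below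
   length [m], against the choice of [m]. *)
case: zm; exists ((c' - c)^-1 *: (y - y')).
  apply: cder_idealZ; apply: cder_idealD => //.
  by rewrite -scaleN1r; apply: cder_idealZ.
move=> p pm; have := xy p pm; rewrite xy' ?leq_max ?pm ?orbT //.
rewrite !cpaD !cpaZ cpaD cpaN => yp.
suff -> : y p - y' p = (c' - c) * z p by rewrite mulKf // subr_eq0.
have -> : y p = c' * z p + y' p - c * z p by rewrite yp addrC addKr.
by rewrite addrAC addrK mulrBl.
Qed.

(** The list is finite because there are finitely many arrows; below a given length, an element is
    therefore a finite combination of paths. *)
Definition words_below n : seq (seq (arrow Q)) :=
  undup (flatten [seq [seq tval t | t <- enum {: m.-tuple (arrow Q)}] | m <- iota 0 n]).

Lemma mem_words_below n s : (size s < n)%N -> s \in words_below n.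
Proof.
move=> sn; rewrite mem_undup; apply/flattenP.
exists [seq tval t | t <- enum {: (size s).-tuple (arrow Q)}].
  by apply/mapP; exists (size s); rewrite // mem_iota.
by apply/mapP; exists (in_tuple s); rewrite ?mem_enum.
Qed.

(** The default 0 is harmless, as [path_elt] also vanishes when the word is not a path from [i]. *)
Definition word_coef (x : A) i s : K :=
  if insub (i, s) is Some p then x p else 0.

Lemma idem_mul_below (x : A) i n p : (plen p < n)%N ->
  (idem i * x) p = (\sum_(s <- words_below n) word_coef x i s *: path_elt K i s) p.
Proof.
move=> pn; rewrite idem_mul cpa_sumE.
rewrite (bigD1_seq (arrows p)) ?undup_uniq ?mem_words_below //= big1 ?addr0 => [|s sp].
  rewrite cpaZ /path_elt val_qpath_eq eqxx andbT.
  case: eqP => [<-|_]; last by rewrite mul0r mulr0.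
  by rewrite mul1r mulr1 /word_coef /arrows -surjective_pairing valK.
rewrite cpaZ /path_elt val_qpath_eq.
by rewrite [_ == s]eq_sym (negPf sp) andbF mulr0.
Qed.

Section Line.
Variables (ws : seq (seq (arrow Q))) (used : {set arrow Q}).
Hypotheses (gd : good_cycles ws used) (th : thin ws used).
Local Notation W := (polygon_potential K ws).

Lemma path_elt_line i j z : one_class ws used i j z -> forall s, exists c y,
  cder_ideal W y /\ path_elt K i s * idem j = c *: (idem i * word_elt z * idem j) + y.
Proof.
move=> zP s.
suff [s0|[c sz]] : path_elt K i s * idem j = 0 \/
    exists c : K, cder_ideal W (word_elt s - c *: word_elt z).
- by exists 0, 0; split; [exact: cder_ideal0|rewrite s0 scale0r addr0].
- exists c, (idem i * (word_elt s - c *: word_elt z) * idem j).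
  split; first by apply: cder_idealMr; apply: cder_idealMl.
  by rewrite path_eltE mulrBr mulrBl -cpa_scaleAr -cpa_scaleAl addrC subrK.
have [/andP[si sj]|/negP nsP] := boolP (is_path i s && (path_end i s == j)).
  by right; apply: wclass_word_elt gd _; apply: zP => //; apply/eqP.
left; apply: cpaP => p; rewrite mul_idem /path_elt.
case: (val p =P (i, s)) => pE; last by rewrite mul0r.
case: eqP => [pj|_]; last by rewrite mulr0.
by case: nsP; rewrite -pj; have := valP p; rewrite /arrows pE /= => ->; rewrite eqxx.
Qed.

(** An infinite combination of paths is truncated below each length; the finite sum is a multiple of
    the representative modulo the ideal, term by term, and [madic_closure_line] makes the scalar
    independent of the length. *)
Lemma idem_line i j : exists z : A, idem i * z = z /\ z * idem j = z /\
  forall x : A, exists c, idem i * x * idem j - c *: z \in jac_ideal W.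
Proof.
have [z zP] : exists z, one_class ws used i j z by case: th.
exists (idem i * word_elt z * idem j); split; first by rewrite !mulrA idem_idem.
split; first by rewrite -!mulrA idem_idem.
move=> x; apply: madic_closure_line => n.
suff [c [y [yW Sy]]] : exists c y, cder_ideal W y /\
    (\sum_(s <- words_below n) word_coef x i s *: path_elt K i s) * idem j =
    c *: (idem i * word_elt z * idem j) + y.
  exists c, y; split=> // p pn; rewrite -Sy !mul_idem.
  by rewrite (idem_mul_below _ _ pn).
elim: words_below => [|s r [c [y [yW Sy]]]].
  exists 0, 0; split; first exact: cder_ideal0.
  by rewrite big_nil mul0r scale0r addr0.
have [c' [y' [y'W sy']]] := path_elt_line zP s.
exists (word_coef x i s * c' + c), (word_coef x i s *: y' + y); split.
  by apply: cder_idealD => //; apply: cder_idealZ.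
rewrite big_cons mulrDl Sy -cpa_scaleAl sy' scalerDr scalerA scalerDl.
by rewrite addrACA.
Qed.

End Line.
End ThinQuotient.

(** * Homomorphisms between projectives as right multiplications *)

Section Homs.
Variables (K : fieldType) (Q : quiver) (W : potential K Q).
Local Notation J := (jacobian W).
Local Notation P := (projective W).
Local Notation E := (jidem W).

Lemma in_projectiveP i (x : J) : reflect (x = x * E i) (x \in @in_projective _ _ W i).
Proof.
have EE : E i * E i = E i.
  by rewrite /jidem -jprojM idem_idem.
apply: (iffP (asboolP _)) => [[y ->]|->]; last by exists x.
by rewrite -mulrA EE.
Qed.

Lemma mul_in_projective j (z x : J) : z = z * E j -> x * z \in @in_projective _ _ W j.
Proof. by move=> zj; apply/in_projectiveP; rewrite -mulrA -zj. Qed.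

Definition right_mul i j (z : J) (zj : z = z * E j) (x : P i) : P j :=
  exist _ (val x * z) (mul_in_projective (val x) zj).

Fact right_mul_linear i j z zj : linear (@right_mul i j z zj).
Proof. by move=> a x y; apply: val_inj; rewrite /= mulrDl -mulrA. Qed.

HB.instance Definition _ i j z zj :=
  GRing.isLinear.Build J (P i) (P j) *:%R (@right_mul i j z zj)
    (@right_mul_linear i j z zj).

End Homs.

Section Schurian.
Variables (K : fieldType) (Q : quiver) (W : potential K Q).
Local Notation J := (jacobian W).
Local Notation P := (projective W).
Local Notation E := (jidem W).

Lemma jidem_in_projective i : E i \in @in_projective _ _ W i.
Proof. by apply/asboolP; exists 1; rewrite mul1r. Qed.

Definition generator i : P i := exist _ (E i) (jidem_in_projective i).

Lemma generatorZ i (x : P i) : x = val x *: generator i.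
Proof. by apply: val_inj; apply/in_projectiveP/(valP x). Qed.

(** As [E i] generates [P i], a homomorphism is right multiplication by the image of [E i], an
    element fixed by [E i] on the left and by [E j] on the right. *)
Lemma hom_val i j (f : {linear P i -> P j}) x :
  val (f x) = val x * (E i * val (f (generator i)) * E j).
Proof.
rewrite {1}[x]generatorZ linearZ; congr (_ * _).
rewrite -mulrA -(in_projectiveP _ _ (valP (f (generator i)))).
by rewrite {1}[generator i]generatorZ linearZ.
Qed.

Lemma schurian_of_lines :
  (forall i j, exists z : J, E i * z = z /\ z * E j = z /\
     forall x : J, exists c, E i * x * E j = c *: z) ->
  schurian W.
Proof.
move=> lines i j; have [z [iz [zj zP]]] := lines i j.
have [z0|z0] := eqVneq z 0.
  (* If the line is zero, every homomorphism vanishes and the empty family is a basis. *)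
  exists 0%N => //; exists (fun k : 'I_0 => False_rect _ (notF (valP k))) => f.
  exists 0; split=> [x|c _]; last by apply/rowP => -[].
  rewrite big_ord0; apply: val_inj; rewrite hom_val.
  by have [c ->] := zP (val (f (generator i))); rewrite z0 scaler0 mulr0.
exists 1%N => //; exists (fun _ => @right_mul _ _ W i j z (esym zj)) => f.
have [c fc] := zP (val (f (generator i))).
(* The scalar acts through left multiplication by [d *: 1], which is central and can be moved next
   to [z]. *)
have vE (d : K) (x : P i) :
    val ((d *: (1 : J)) *: @right_mul _ _ W i j z (esym zj) x) = val x * (d *: z).
  by rewrite /= -[LHS]jac_scaleAl mul1r jac_scaleAr.
exists (const_mx c); split=> [x|c' fc'].
  by rewrite big_ord1 mxE; apply: val_inj; rewrite vE hom_val fc.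
(* Uniqueness of the coefficient follows by evaluation at the generator, since [z] is nonzero. *)
apply/rowP => k; rewrite ord1 mxE; apply/eqP; rewrite -subr_eq0.
have : val (f (generator i)) = E i * (c' 0 0 *: z) by rewrite fc' big_ord1 vE.
rewrite hom_val fc -!jac_scaleAr iz => cz.
have : (c - c' 0 0) *: z = 0 by rewrite scalerBl; apply/eqP; rewrite subr_eq0 cz.
by move/eqP; rewrite scaler_eq0 (negPf z0) orbF.
Qed.

End Schurian.

(** * From thin polygon trees to schurian Jacobian algebras *)

Lemma thin_schurian (K : fieldType) (Q : quiver) (ws : seq (seq (arrow Q)))
    (used : {set arrow Q}) :
  good_cycles ws used -> thin ws used -> schurian (polygon_potential K ws).
Proof.
move=> gd th; apply: schurian_of_lines => i j.
have [z [iz [zj zP]]] := idem_line K gd th i j.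
exists (jproj _ z); split; first by rewrite -jprojM iz.
split; first by rewrite -jprojM zj.
move=> x; have [c xc] := zP (repr x); exists c.
have -> : jidem (polygon_potential K ws) i * x * jidem (polygon_potential K ws) j =
    jproj (polygon_potential K ws) (path_elt K i [::] * repr x * path_elt K j [::]).
  by rewrite !jprojM jprojK.
by rewrite -jprojZ; apply/jprojP.
Qed.

Lemma polygon_tree_thin (Q : quiver) (ws : seq (seq (arrow Q))) (used : {set arrow Q}) :
  polygon_tree ws used -> good_cycles ws used /\ thin ws used.
Proof.
elim=> {Q ws used} [n n2|Q ws used a n b _ [gd th] au n2
  |Q Q' ws used fv fa _ [gd th] fvB faB fv_src fv_tgt].
- by split; [apply: cycle_quiver_good|apply: cycle_quiver_thin]; apply: ltnW.
- by split; [apply: glue_good|apply: glue_thin].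
- split; first exact: (good_cycles_iso faB fv_src fv_tgt gd).
  exact: (thin_iso fvB faB fv_src fv_tgt th).
Qed.

Theorem theorem3p11 (K : closedFieldType) (Q : quiver)
    (ws : seq (seq (arrow Q))) (used : {set arrow Q})
    (HQ : polygon_tree ws used) :
  schurian (polygon_potential K ws).
Proof. by have [gd th] := polygon_tree_thin HQ; apply: thin_schurian gd th. Qed.
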